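(* Let $E$ be a Banach space and suppose $\mathrm{FBL}^{(p)}[E]$ is $q$-convex for some $1\le p<q$. Then $\mathrm{FBL}^{(r)}[E]$ is $q$-convex for all $1\le r\le\infty$.
   Context: Banach spaces are real. $H[E]$ is the vector lattice (pointwise operations) of positively homogeneous functions $f:E^*\to\mathbb R$. For $1\le r<\infty$ put $\|f\|_{\mathrm{FBL}^{(r)}[E]}=\sup\{(\sum_{k=1}^n|f(x_k^* )|^r)^{1/r}: n\in\mathbb N,\ x_1^*,\dots,x_n^*\in E^*,\ \sup_{x\in B_E}\sum_{k=1}^n|x_k^*(x)|^r\le 1\}$, and for $r=\infty$ put $\|f\|_{\mathrm{FBL}^{(\infty)}[E]}=\sup_{x^*\in B_{E^*}}|f(x^* )|$. For $x\in E$ let $\delta_x(x^* )=x^*(x)$. $\mathrm{FBL}^{(r)}[E]$ is the closure, in the space of $f\in H[E]$ with finite norm, of the sublattice generated by $\{\delta_x:x\in E\}$. A Banach lattice $X$ is $q$-convex if there is $M$ with $\|(\sum_{k=1}^n|x_k|^q)^{1/q}\|\le M(\sum_{k=1}^n\|x_k\|^q)^{1/q}$ for all $x_1,\dots,x_n\in X$ (for $q=\infty$: $\|\bigvee_k|x_k|\|\le M\max_k\|x_k\|$). *)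

(* Defs.v *)
From HB Require Import structures.
From mathcomp Require Import all_boot all_order all_algebra.
From mathcomp Require Import all_classical all_reals all_analysis.

Set Implicit Arguments.
Unset Strict Implicit.
Unset Printing Implicit Defensive.

Import Order.TTheory GRing.Theory Num.Theory.
Import numFieldNormedType.Exports.

Local Open Scope classical_set_scope.
Local Open Scope ring_scope.

Section Dual.
Context {R : realType} (E : normedModType R).

Definition dual_pred : {pred E -> R^o} :=
  mem [set f : E -> R^o | linear f /\ continuous f].

Lemma dual_pred_submod_closed : submod_closed dual_pred.
Proof.
split; first by rewrite inE; split=> [a x y|x];
  [rewrite /= scaler0 addr0 | exact: cvg_cst].
move=> a f g; rewrite !inE => -[lf cf] [lg cg]; split=> [b x y|x].
  rewrite !fctE lf lg !scalerDr !scalerA (mulrC b a) -!addrA; congr (_ + _).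
  by rewrite addrCA.
by apply: cvgD; [apply: cvgZr; exact: cf | exact: cg].
Qed.

HB.instance Definition _ :=
  GRing.isSubmodClosed.Build R (E -> R^o) dual_pred dual_pred_submod_closed.

Record dual := Dual { dual_fun :> E -> R^o ; _ : dual_fun \in dual_pred }.

HB.instance Definition _ := [isSub for dual_fun].
HB.instance Definition _ := [Choice of dual by <:].
HB.instance Definition _ := [SubChoice_isSubLmodule of dual by <:].

Definition unit_ball : set E := [set x | `|x| <= 1].

Definition dual_norm (f : dual) : \bar R :=
  ereal_sup [set `|f x : R|%:E | x in unit_ball].

Definition dual_unit_ball : set dual := [set f | (dual_norm f <= 1)%E].

End Dual.

Arguments unit_ball {R} E.
Arguments dual_unit_ball {R} E.

Section FunctionLattice.
Context {R : realType} {T : Type}.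
Implicit Types (f g : T -> R) (L X : set (T -> R)) (N : (T -> R) -> \bar R).

Definition is_sublattice L :=
  [/\ L (fun=> 0),
      (forall (a : R) f g, L f -> L g -> L (fun t => a * f t + g t)) &
      (forall f g, L f -> L g ->
         L (fun t => Num.max (f t) (g t)) /\ L (fun t => Num.min (f t) (g t)))].

Definition generated_sublattice (G : set (T -> R)) : set (T -> R) :=
  smallest is_sublattice G.

(* [X] is a Banach lattice of functions, with pointwise operations and norm [N].
   Evaluations at points are lattice homomorphisms, hence commute with
   Krivine's functional calculus, so that the element
   (|x_1|^q + ... + |x_n|^q)^(1/q) of [X] is computed pointwise.
   The norm is extended-real valued, and finite on [X]. *)
Definition q_convex X N (q : \bar R) : Prop :=
  match q with
  | q0%:E => exists M : R, forall (n : nat) (x : 'I_n -> T -> R),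
      (forall k, X (x k)) ->
      (N (fun t => (\sum_(k < n) `|x k t| `^ q0) `^ q0^-1)%R
        <= M%:E * (\sum_(k < n) N (x k) `^ q0) `^ q0^-1%R)%E
  | +oo%E => exists M : R, forall (n : nat) (x : 'I_n -> T -> R),
      (forall k, X (x k)) ->
      (N (fun t => \big[Num.max/0]_(k < n) `|x k t|)%R
        <= M%:E * \big[maxe/0]_(k < n) N (x k))%E
  | -oo%E => False
  end.

End FunctionLattice.

Section FreeBanachLattice.
Context {R : realType} (E : normedModType R).

Definition pos_homogeneous : set (dual E -> R) :=
  [set f | forall (a : R) (u : dual E), 0 <= a -> f (a *: u) = a * f u].

(* Exponents are extended reals in [1, +oo]; the value at -oo is junk. The empty
   family (n = 0) is allowed and only contributes the value 0. *)
Definition fbl_norm (r : \bar R) (f : dual E -> R) : \bar R :=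
  match r with
  | r0%:E => ereal_sup
      [set v | exists (n : nat) (u : 'I_n -> dual E),
         (ereal_sup [set (\sum_(k < n) `|u k x : R| `^ r0)%:E
                    | x in unit_ball E] <= 1)%E /\
         v = ((\sum_(k < n) `|f (u k)| `^ r0) `^ r0^-1)%:E]
  | +oo%E => ereal_sup [set `|f u|%:E | u in dual_unit_ball E]
  | -oo%E => 0%E
  end.

Definition delta (x : E) : dual E -> R := fun u => u x.

(* The closure of the sublattice generated by the evaluations, taken inside the
   space of positively homogeneous functions of finite norm. *)
Definition FBL (r : \bar R) : set (dual E -> R) :=
  [set f | [/\ pos_homogeneous f, (fbl_norm r f < +oo)%E &
     forall e : R, 0 < e ->
       exists2 g, generated_sublattice (range delta) g &
         (fbl_norm r (fun u => f u - g u)%R < e%:E)%E]].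

Definition FBL_q_convex (r q : \bar R) : Prop := q_convex (FBL r) (fbl_norm r) q.

End FreeBanachLattice.

Arguments pos_homogeneous {R} E.
Arguments FBL {R} E r.

(* Main.v *)
(* Fix q finite. For positively homogeneous f the norms ||f||_r decrease in r,
   and ||.||_r is q-convex with constant 1 when r >= q (Minkowski). So for r < q
   it suffices to prove ||f||_r <= C ||f||_q, and by monotonicity only for
   r <= p. There, following Maurey, a weakly r-summable family u_1, ..., u_n
   is rewritten as g_k^(1/r) v_k with g_k > 0, where the v_k satisfy
   \sum_k g_k |v_k(x)|^q <= C ||x||^q. The density g comes from nearly maximising
   \sum_k a_k^(r/q) over the vectors a_k = \sum_i |u_k(x_i)|^q with
   \sum_i ||x_i||^q <= 1. The total mass of g is bounded independently of n and u
   by extrapolation: interpolating between r and q turns (u_k) into a weakly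
   p-summable family, to which the q-convexity of FBL^(p) is applied at the
   elements delta_{x_i}. For q = oo one takes g_k = ||u_k||^r. *)
Require Import Defs.
From mathcomp Require Import all_boot all_order all_algebra.
From mathcomp Require Import all_classical all_reals all_analysis.
From mathcomp Require Import ring lra.
Import Order.TTheory GRing.Theory Num.Theory.
Import numFieldNormedType.Exports.
Local Open Scope ring_scope.

(** * Real powers: weighted AM-GM, Hölder's inequality and near-maximisation of a concave sum *)

Section RealPowers.
Context {R : realType}.
Implicit Types (x y z a b r s t l : R).

Lemma ler_powRl r x y : 0 <= r -> 0 <= x -> x <= y -> x `^ r <= y `^ r.
Proof.
by move=> r0 x0 xy; rewrite ge0_ler_powR// nnegrE// (le_trans x0).
Qed.

Lemma ler_powRl_inv r x y : 0 < r -> 0 <= x -> 0 <= y ->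
  (x `^ r <= y `^ r) = (x <= y).
Proof.
move=> r0 x0 y0; apply/idP/idP => [|xy]; last by rewrite ler_powRl// ltW.
by apply: contraTT; rewrite -!ltNge => yx; rewrite gt0_ltr_powR.
Qed.

Lemma ler_npowRl r x y : r <= 0 -> 0 < x -> x <= y -> y `^ r <= x `^ r.
Proof.
move=> r0 x0 xy; have y0 : 0 < y := lt_le_trans x0 xy.
rewrite -[r]opprK powRN [leRHS]powRN lef_pV2 ?posrE ?powR_gt0//.
by rewrite ler_powRl ?oppr_ge0// ltW.
Qed.

Lemma powR_le1 r x : 0 <= r -> 0 <= x -> x <= 1 -> x `^ r <= 1.
Proof.
by move=> r0 x0 x1; apply: le_trans (ler_powRl r x 1 r0 x0 x1) _; rewrite powR1.
Qed.

Lemma le_powR_le1 z s : 0 <= z <= 1 -> s <= 1 -> z <= z `^ s.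
Proof.
move=> /andP[]; rewrite le_eqVlt => /predU1P[<- _ _|z0 z1 s1].
  exact: powR_ge0.
by rewrite ger1_powR// z0.
Qed.

Lemma gt0_powRD x r s : 0 < x -> x `^ (r + s) = x `^ r * x `^ s.
Proof. by move=> x0; rewrite powRD// (gt_eqF x0) implybT. Qed.

Lemma powRMX x y a b r : (x `^ a * y `^ b) `^ r = x `^ (a * r) * y `^ (b * r).
Proof. by rewrite powRM ?powR_ge0// -!powRrM. Qed.

Lemma powRK r x : r != 0 -> 0 <= x -> (x `^ r) `^ r^-1 = x.
Proof. by move=> r0 x0; rewrite -powRrM divff// powRr1. Qed.

Lemma powRVK r x : r != 0 -> 0 <= x -> (x `^ r^-1) `^ r = x.
Proof. by move=> r0 x0; rewrite -powRrM mulVf// powRr1. Qed.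

Lemma poweR_sum_EFin (I : finType) (a : I -> \bar R) (N : I -> R) r :
  (forall i, a i = (N i)%:E) ->
  ((\sum_i a i `^ r) `^ r^-1)%E = ((\sum_i N i `^ r) `^ r^-1)%:E.
Proof.
move=> aN; rewrite (eq_bigr (fun i => (N i `^ r)%:E)) ?sumEFin ?poweR_EFin//.
by move=> i _; rewrite aN poweR_EFin.
Qed.

Lemma weighted_amgm a b l : 0 <= a -> 0 <= b -> 0 <= l <= 1 ->
  a `^ l * b `^ (1 - l) <= l * a + (1 - l) * b.
Proof.
move=> a0 b0 /andP[]; rewrite le_eqVlt => /predU1P[<- _|l0].
  by rewrite powRr0 subr0 powRr1// mul0r mul1r add0r.
rewrite le_eqVlt => /predU1P[->|l1].
  by rewrite subrr powRr0 powRr1// mul0r !mulr1 mul1r addr0.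
have l10 : 0 < 1 - l by rewrite subr_gt0.
have := @conjugate_powR _ (a `^ l) (b `^ (1 - l)) l^-1 (1 - l)^-1.
rewrite !powR_ge0 !invr_gt0 l0 l10 !invrK subrKC => /(_ isT isT isT isT erefl).
by rewrite !powRK ?gt_eqF// !(mulrC _ l) !(mulrC _ (1 - l)).
Qed.

(** Concavity: the graph of t^s lies below its tangent at [y]. This is weighted AM-GM multiplied by
    y^(s-1). *)
Lemma powR_tangent s x y : 0 <= s <= 1 -> 0 <= x -> 0 < y ->
  x `^ s <= y `^ s + s * y `^ (s - 1) * (x - y).
Proof.
move=> s01 x0 y0; have := weighted_amgm x y s x0 (ltW y0) s01.
have e : y `^ (s - 1) * y `^ (1 - s) = 1.
  by rewrite -gt0_powRD// (_ : _ + _ = 0) ?powRr0//; ring.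
have e2 : y `^ s = y `^ (s - 1) * y.
  by rewrite -[in LHS](subrK 1 s) [LHS]gt0_powRD// powRr1 ?ltW.
move=> /(ler_wpM2l (powR_ge0 y (s - 1))).
have -> : y `^ (s - 1) * (x `^ s * y `^ (1 - s)) = x `^ s.
  by rewrite mulrCA e mulr1.
by move=> /le_trans; apply; rewrite e2; lra.
Qed.

(** Hölder's inequality with exponents 1/l and 1/(1-l), obtained from weighted AM-GM applied to
    A_k/a and B_k/b termwise. *)
Lemma holder_sum (I : finType) (A B : I -> R) a b l :
  (forall k, 0 <= A k) -> (forall k, 0 <= B k) ->
  \sum_k A k <= a -> \sum_k B k <= b -> 0 <= l <= 1 ->
  \sum_k A k `^ l * B k `^ (1 - l) <= a `^ l * b `^ (1 - l).
Proof.
move=> A0 B0 Aa Bb /andP[l0 l1].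
have a0 : 0 <= a by apply: le_trans Aa; exact: sumr_ge0.
have b0 : 0 <= b by apply: le_trans Bb; exact: sumr_ge0.
have sumr0 (C : I -> R) : (forall k, 0 <= C k) -> \sum_k C k <= 0 ->
    forall k, C k = 0.
  move=> C0 s0 k; apply/eqP; rewrite eq_le C0 andbT.
  by apply: le_trans s0; rewrite (bigD1 k)//= ler_wpDr// sumr_ge0.
(* The endpoints come first because 0^0 = 1; once they are excluded, [a = 0] or [b = 0] makes both
   sides vanish. *)
have [->|lN0] := eqVneq l 0.
  rewrite powRr0 mul1r subr0 powRr1//; apply: le_trans Bb.
  by apply: ler_sum => k _; rewrite powRr0 mul1r powRr1.
have [->|lN1] := eqVneq l 1.
  rewrite subrr powRr0 mulr1 powRr1//; apply: le_trans Aa.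
  by apply: ler_sum => k _; rewrite powRr0 mulr1 powRr1.
have l1N0 : 1 - l != 0 by rewrite subr_eq0 eq_sym.
have [aE|aN0] := eqVneq a 0.
  rewrite aE powR0// mul0r big1// => k _.
  by rewrite (sumr0 A) ?powR0 ?mul0r//; move: Aa; rewrite aE.
have [bE|bN0] := eqVneq b 0.
  rewrite bE powR0// mulr0 big1// => k _.
  by rewrite (sumr0 B) ?powR0 ?mulr0//; move: Bb; rewrite bE.
have ap : 0 < a by rewrite lt_neqAle eq_sym aN0.
have bp : 0 < b by rewrite lt_neqAle eq_sym bN0.
have C0 : 0 < a `^ l * b `^ (1 - l) by rewrite mulr_gt0 ?powR_gt0.
rewrite -[leRHS]mulr1; apply: le_trans (_ : _ <= (a `^ l * b `^ (1 - l)) *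
    \sum_k (l * (A k / a) + (1 - l) * (B k / b))) _.
  rewrite mulr_sumr; apply: ler_sum => k _.
  have Aa0 : 0 <= A k / a by rewrite divr_ge0.
  have Bb0 : 0 <= B k / b by rewrite divr_ge0.
  apply: le_trans (ler_wpM2l (ltW C0) (weighted_amgm _ _ _ Aa0 Bb0 _)); last first.
    by rewrite l0 l1.
  by rewrite mulrACA -!powRM// ![_ * (_ / _)]mulrC !divfK.
rewrite ler_pM2l// big_split/= -!mulr_sumr -!mulr_suml.
have : l * (\sum_k A k / a) <= l.
  by rewrite -mulr_suml ler_piMr// ler_pdivrMr// mul1r.
have : (1 - l) * (\sum_k B k / b) <= 1 - l.
  by rewrite -mulr_suml ler_piMr ?subr_ge0// ler_pdivrMr// mul1r.
by rewrite -!mulr_suml; lra.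
Qed.

(* Instead of an exact maximiser of the concave functional
   [a |-> \sum_k (a k + eps) `^ s], whose first-order condition would need
   compactness, a sufficiently good approximate one is enough. *)
Lemma near_maximizer_density n (S : set ('I_n -> R)) s (eps : R) :
  0 < s < 1 -> 0 < eps -> S !=set0%classic ->
  (forall (a : 'I_n -> R) k, S a -> 0 <= a k <= 1) ->
  (forall t (a b : 'I_n -> R), 0 <= t <= 1 -> S a -> S b ->
     S (fun k => (1 - t) * a k + t * b k)) ->
  exists2 a : 'I_n -> R, S a & forall b : 'I_n -> R, S b ->
    \sum_k (a k + eps) `^ (s - 1) * b k <= 6 * \sum_k (a k + eps) `^ s.
Proof.
move=> /andP[s0 s1] eps0 [a0 Sa0] S01 cvxS.
case: n => [|n] in S a0 Sa0 S01 cvxS *.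
  by exists a0 => // b Sb; rewrite !big_ord0 mulr0.
pose P (a : 'I_n.+1 -> R) := \sum_k (a k + eps) `^ s.
(* Entries of [a] and [b] lie in [0, 1], so a step t <= eps/2 towards [b] changes a_k + eps by a
   factor of at most 2 either way. *)
have [t [t0 t1 te]] : exists t, [/\ 0 < t, t <= 1 & t <= eps / 2].
  exists (Num.min eps 1 / 2); rewrite divr_gt0 ?lt_min ?eps0//=.
  split=> //; last by rewrite ler_pM2r// ge_min lexx.
  rewrite ler_pdivrMr// mul1r (le_trans (_ : _ <= 1)) ?ge_min ?lexx ?orbT//.
  by rewrite ler1n.
have hS : has_sup [set P a | a in S]%classic.
  split; first by exists (P a0); exists a0.
  exists (\sum_(k < n.+1) (1 + eps) `^ s) => _ [a Sa <-].
  apply: ler_sum => k _; have /andP[? ?] := S01 a k Sa.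
  by apply: ler_powRl; lra.
(* Tolerance in the supremum: divided by s t it becomes eps^s, which is at most [P a] since there is
   at least one index. *)
have eta0 : 0 < s * t * eps `^ s by rewrite !mulr_gt0// powR_gt0.
have [_ [a Sa <-] aP] := sup_adherent eta0 hS.
exists a => // b Sb.
have cP : P (fun k => (1 - t) * a k + t * b k) <= sup [set P a | a in S]%classic.
  apply: ub_le_sup; first by case: hS.
  exists (fun k => (1 - t) * a k + t * b k) => //.
  by apply: cvxS => //; rewrite (ltW t0).
pose x k := a k + eps.
pose y k := (1 - t) * a k + t * b k + eps.
have xy k : [/\ 0 < x k, 0 < y k, x k / 2 <= y k & y k <= 2 * x k].
  have /andP[? ?] := S01 a k Sa; have /andP[? ?] := S01 b k Sb.
  have ? : y k = x k + t * (b k - a k) by rewrite /x /y; ring.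
  have ? : t * (b k - a k) <= t * 1 by rewrite ler_pM2l//; lra.
  have ? : t * (-1) <= t * (b k - a k) by rewrite ler_pM2l//; lra.
  have ? : x k = a k + eps by [].
  by split; lra.
(* The tangent is taken at the displaced point [y], so it bounds [P a] from above; near maximality
   then bounds the slope in the direction b - a. *)
have : P a <= P (fun k => (1 - t) * a k + t * b k) +
    s * t * \sum_k y k `^ (s - 1) * (a k - b k).
  rewrite mulr_sumr -big_split/=; apply: ler_sum => k _.
  have [x0 y0 _ _] := xy k.
  apply: le_trans (powR_tangent s _ _ _ (ltW x0) y0) _; first by rewrite !ltW.
  have -> : x k - y k = t * (a k - b k) by rewrite /x /y; ring.
  by rewrite -/(x k) -/(y k); lra.
move=> Pa; have {}Pa : \sum_k y k `^ (s - 1) * (b k - a k) <= eps `^ s.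
  rewrite -(ler_pM2l (mulr_gt0 s0 t0)).
  have -> : \sum_k y k `^ (s - 1) * (b k - a k) =
      - \sum_k y k `^ (s - 1) * (a k - b k).
    by rewrite -sumrN; apply: eq_bigr => k _; ring.
  by rewrite mulrN; lra.
have two : 2^-1 <= 2 `^ (s - 1) :> R.
  by rewrite -[leLHS]powR_inv1// ler_powR//; lra.
have yx k : y k `^ (s - 1) <= 2 * x k `^ (s - 1).
  have [x0 y0 xy2 _] := xy k.
  apply: le_trans (ler_npowRl _ _ _ _ _ xy2) _; [lra|by rewrite divr_gt0|].
  rewrite powRM ?invr_ge0 ?(ltW x0)// [leLHS]mulrC.
  apply: ler_wpM2r; first exact: powR_ge0.
  by rewrite -powR_inv1// -powRrM -[leRHS]powRr1// ler_powR//; lra.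
have xley k : x k `^ (s - 1) <= 2 * y k `^ (s - 1).
  have [x0 y0 _ yx2] := xy k.
  have : (2 * x k) `^ (s - 1) <= y k `^ (s - 1) by apply: ler_npowRl => //; lra.
  rewrite powRM ?(ltW x0)// => h.
  have := ler_wpM2r (powR_ge0 (x k) (s - 1)) two; lra.
have V : eps `^ s <= P a.
  rewrite /P (bigD1 ord0)//= ler_wpDr ?sumr_ge0// => [k _|]; first exact: powR_ge0.
  by have /andP[? ?] := S01 a ord0 Sa; apply: ler_powRl; lra.
have h1 : \sum_k x k `^ (s - 1) * b k <= 2 * \sum_k y k `^ (s - 1) * b k.
  rewrite mulr_sumr; apply: ler_sum => k _; rewrite mulrA ler_wpM2r//.
  by have /andP[] := S01 b k Sb.
have h2 : \sum_k y k `^ (s - 1) * a k <= 2 * P a.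
  rewrite mulr_sumr; apply: ler_sum => k _.
  have [x0 _ _ _] := xy k.
  have /andP[? ?] := S01 a k Sa.
  rewrite -(@mulr_powRB1 _ (a k + eps) s) -/(x k) ?(ltW x0)//.
  apply: le_trans (_ : _ <= 2 * x k `^ (s - 1) * x k) _; last by lra.
  by apply: ler_pM => //; [exact: powR_ge0 | rewrite /x; lra].
have h3 : \sum_k y k `^ (s - 1) * b k =
    \sum_k y k `^ (s - 1) * (b k - a k) + \sum_k y k `^ (s - 1) * a k.
  by rewrite -big_split; apply: eq_bigr => k _ /=; ring.
(* The constant is 6 = 2 (1 + 2): the outer 2 is from [h1], the 1 from eps^s <= [P a], the inner 2
   from [h2]. *)
by rewrite -/(P a) -/x; lra.
Qed.

End RealPowers.

(** * The norms of FBL^(r): reduction to real sums, monotonicity in r, convexity *)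

Section FBLNorm.
Context {R : realType} {E : normedModType R}.
Implicit Types (r q N : R) (f : dual E -> R) (u : dual E) (x : E).

Lemma dual_linear u : linear u.
Proof. by case: u => u uP; have := uP; rewrite {1}inE => -[]. Qed.

Lemma dualZ (c : R) u x : (c *: u) x = c * u x.
Proof. by []. Qed.

Lemma dual_homog u (c : R) x : u (c *: x) = c * u x.
Proof.
have u0 : u 0 = 0.
  have := dual_linear u 1 0 0; rewrite scaler0 scale1r addr0 => h.
  by apply: (@addrI _ (u 0)); rewrite addr0 -h.
by have := dual_linear u c x 0; rewrite u0 !addr0.
Qed.

Definition weakly_summing r n (u : 'I_n -> dual E) : Prop :=
  forall x, `|x| <= 1 -> \sum_(k < n) `|u k x : R| `^ r <= 1.

Lemma weakly_summing_le r n (u : 'I_n -> dual E) x : 0 < r ->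
  weakly_summing r n u -> \sum_(k < n) `|u k x : R| `^ r <= `|x| `^ r.
Proof.
move=> r0 hu.
have [->|x0] := eqVneq x 0.
  rewrite normr0 powR0 ?gt_eqF// big1// => k _.
  by rewrite -(scale0r 0) dual_homog mul0r normr0 powR0 ?gt_eqF.
have nx0 : 0 < `|x| by rewrite normr_gt0.
have := hu (`|x|^-1 *: x); rewrite normrZ normfV normr_id mulVf ?gt_eqF// lexx.
move=> /(_ isT) h.
rewrite (eq_bigr (fun k => `|x| `^ r * `|u k (`|x|^-1 *: x) : R| `^ r)).
  by rewrite -mulr_sumr ler_piMr ?powR_ge0.
move=> k _; rewrite -powRM ?normr_ge0// dual_homog normrM normfV normr_id.
by rewrite mulVKf ?gt_eqF.
Qed.

Lemma weakly_summing_le1 r n (u : 'I_n -> dual E) k x : 0 < r ->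
  weakly_summing r n u -> `|u k x : R| <= `|x|.
Proof.
move=> r0 hu; rewrite -(ler_powRl_inv r)//.
apply: le_trans (weakly_summing_le _ _ _ _ r0 hu).
by rewrite (bigD1 k)//= lerDl sumr_ge0// => i _; exact: powR_ge0.
Qed.

Lemma fbl_norm_leP r f N : 0 < r -> 0 <= N ->
  (fbl_norm r%:E f <= N%:E)%E <->
  (forall n (u : 'I_n -> dual E), weakly_summing r n u ->
     \sum_(k < n) `|f (u k)| `^ r <= N `^ r).
Proof.
move=> r0 N0; split=> [h n u hu|h].
  rewrite -(@ler_powRl_inv _ r^-1) ?invr_gt0 ?powR_ge0//; last first.
    by apply: sumr_ge0 => k _; exact: powR_ge0.
  rewrite (powRK r N) ?gt_eqF// -lee_fin; apply: le_trans h.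
  apply: ereal_sup_ubound; exists n, u; split => //.
  by apply: ge_ereal_sup => _ [x xB <-]; rewrite lee_fin hu.
apply: ge_ereal_sup => _ [n [u [hu ->]]]; rewrite lee_fin.
rewrite -(powRK r N) ?gt_eqF//; apply: ler_powRl; first by rewrite invr_ge0 ltW.
  by apply: sumr_ge0 => k _; exact: powR_ge0.
apply: h => x xB; rewrite -lee_fin; apply: le_trans hu.
by apply: ereal_sup_ubound; exists x.
Qed.

Lemma fbl_norm_inf_leP f N :
  (fbl_norm +oo%E f <= N%:E)%E <->
  (forall u, (forall x, `|x| <= 1 -> `|u x : R| <= 1) -> `|f u| <= N).
Proof.
split=> [h u hu|h].
  rewrite -lee_fin; apply: le_trans h; apply: ereal_sup_ubound; exists u => //.
  by apply: ge_ereal_sup => _ [x xB <-]; rewrite lee_fin hu.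
apply: ge_ereal_sup => _ [u hu <-]; rewrite lee_fin; apply: h => x xB.
rewrite -lee_fin; apply: le_trans hu.
by apply: ereal_sup_ubound; exists x.
Qed.

Lemma fbl_norm_ge0 (r : \bar R) f : (1 <= r)%E -> (0 <= fbl_norm r f)%E.
Proof.
case: r => [r| |] //; rewrite ?lee_fin => r1.
  apply: ereal_sup_ubound; exists 0%N, (fun=> 0); rewrite big_ord0 powR0.
    split=> //; apply: ge_ereal_sup => _ [x _ <-].
    by rewrite big_ord0 lee_fin ler01.
  by rewrite invr_eq0 gt_eqF// (lt_le_trans ltr01).
apply: (@le_trans _ _ `|f 0|%:E); first by rewrite lee_fin.
apply: ereal_sup_ubound; exists 0 => //.
by apply: ge_ereal_sup => _ [x _ <-]; rewrite normr0 lee_fin ler01.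
Qed.

Lemma fbl_norm_fin (r : \bar R) f : (1 <= r)%E -> FBL E r f ->
  exists2 N, 0 <= N & fbl_norm r f = N%:E.
Proof.
move=> r1 [_ fy _]; have := fbl_norm_ge0 r f r1.
by case: (fbl_norm r f) fy => [N| |]// _; rewrite lee_fin; exists N.
Qed.

Lemma fbl_norm_delta r x : 0 < r -> (fbl_norm r%:E (delta x) <= `|x|%:E)%E.
Proof.
move=> r0; apply/fbl_norm_leP => // n u hu.
exact: weakly_summing_le.
Qed.

Lemma FBL_delta r x : 1 <= r -> FBL E r%:E (delta x).
Proof.
move=> r1; have r0 : 0 < r by apply: lt_le_trans r1.
split.
- by move=> a u _; rewrite /delta dualZ.
- exact: le_lt_trans (fbl_norm_delta _ _ r0) (ltry _).
- move=> e e0; exists (delta x).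
    by move=> L [_ GL]; apply: GL; exists x.
  apply: (@le_lt_trans _ _ 0%:E); last by rewrite lte_fin.
  apply/fbl_norm_leP => // n u hu; rewrite powR0 ?gt_eqF//.
  by rewrite big1// => k _; rewrite subrr normr0 powR0 ?gt_eqF.
Qed.

(** A weakly q-summing family [w] becomes weakly r-summing, by Hölder, after scaling by suitable
    [al]. By positive homogeneity, testing the r-norm on the scaled family gives F^(r/q) <= N^r. *)
Lemma fbl_norm_antitone_fin r q f N : 0 < r -> r <= q -> 0 <= N ->
  pos_homogeneous E f ->
  (fbl_norm r%:E f <= N%:E)%E -> (fbl_norm q%:E f <= N%:E)%E.
Proof.
move=> r0 rq N0 hf hN; have q0 : 0 < q := lt_le_trans r0 rq.
apply/(fbl_norm_leP q f N q0 N0) => n w hw.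
pose y k := `|f (w k)|; pose F := \sum_(k < n) y k `^ q.
rewrite -/F; have F0 : 0 <= F by apply: sumr_ge0 => k _; exact: powR_ge0.
move: F0; rewrite le_eqVlt => /predU1P[<-|F0]; first exact: powR_ge0.
(* Chosen so that al_k^r = (y_k^q / F)^(1 - r/q), a power of weights of total mass 1. *)
pose al k := y k `^ (q / r - 1) * F `^ (q^-1 - r^-1).
have al0 k : 0 <= al k by rewrite mulr_ge0 ?powR_ge0.
have lam : 0 <= r / q <= 1.
  by rewrite divr_ge0 ?(ltW r0) ?(ltW q0)// ler_pdivrMr// mul1r.
have alr k : al k `^ r = (y k `^ q / F) `^ (1 - r / q).
  rewrite /al !powRM ?powR_ge0 ?invr_ge0 ?(ltW F0)// -!powRrM.
  rewrite -[F^-1]powR_inv1 ?(ltW F0)// -powRrM.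
  congr (_ `^ _ * _ `^ _); field; lra.
have hu : weakly_summing r n (fun k => al k *: w k).
  move=> x x1.
  rewrite (eq_bigr (fun k => (`|w k x : R| `^ q) `^ (r / q)
                            * (y k `^ q / F) `^ (1 - r / q))).
    rewrite -[leRHS](_ : 1 `^ (r / q) * 1 `^ (1 - r / q) = 1).
      apply: holder_sum => [k|k||//|//]; rewrite ?divr_ge0 ?powR_ge0 ?(ltW F0)//.
      - exact: hw.
      - by rewrite -mulr_suml divff ?gt_eqF.
    by rewrite !powR1 mulr1.
  move=> k _; rewrite dualZ normrM (ger0_norm (al0 k)) [LHS]powRM// alr mulrC.
  by rewrite -powRrM (_ : q * (r / q) = r)//; field; rewrite gt_eqF.
have /(fbl_norm_leP r f N r0 N0) /(_ n _ hu) := hN.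
rewrite (eq_bigr (fun k => y k `^ q * F `^ (r / q - 1))); last first.
  move=> k _; rewrite hf// normrM (ger0_norm (al0 k)) powRM// alr -/(y k).
  have [->|yN0] := eqVneq (y k) 0.
    by rewrite [X in _ * X]powR0 ?gt_eqF// mulr0 powR0 ?gt_eqF// mul0r.
  have y0 : 0 < y k by rewrite lt_neqAle eq_sym yN0/= /y.
  rewrite powRM ?powR_ge0 ?invr_ge0 ?(ltW F0)//.
  rewrite -[F^-1]powR_inv1 ?(ltW F0)// -!powRrM mulrAC -gt0_powRD//.
  congr (_ `^ _ * _ `^ _); field; lra.
rewrite -mulr_suml -/F mulr_powRB1 ?(ltW F0) ?divr_gt0// => h.
rewrite -(@ler_powRl_inv _ (r / q)) ?divr_gt0 ?powR_ge0 ?(ltW F0)//.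
by rewrite -powRrM (_ : q * (r / q) = r)//; field; rewrite gt_eqF.
Qed.

(** A single functional in the dual ball is a weakly r-summing family of length one. *)
Lemma fbl_norm_antitone_inf r f N : 0 < r -> 0 <= N ->
  (fbl_norm r%:E f <= N%:E)%E -> (fbl_norm +oo%E f <= N%:E)%E.
Proof.
move=> r0 N0 /(fbl_norm_leP r f N r0 N0) h; apply/fbl_norm_inf_leP => u hu.
rewrite -(@ler_powRl_inv _ r)//.
have := h 1%N (fun=> u); rewrite big_ord1; apply => x x1.
by rewrite big_ord1 powR_le1 ?(ltW r0)//; exact: hu.
Qed.

(** Minkowski's inequality in l^(r/q), via Hölder with the weights N_i^q. Their total [T] does not
    depend on the functional, so summing over the family uses only the bound on each f_i. *)
Lemma fbl_norm_convex_fin r q n (f : 'I_n -> dual E -> R) (N : 'I_n -> R) :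
  0 < q -> q <= r -> (forall i, 0 <= N i) ->
  (forall i, (fbl_norm r%:E (f i) <= (N i)%:E)%E) ->
  (fbl_norm r%:E (fun u => (\sum_i `|f i u| `^ q) `^ q^-1)%R
     <= ((\sum_i N i `^ q) `^ q^-1)%R%:E)%E.
Proof.
move=> q0 qr N0 fN; have r0 : 0 < r := lt_le_trans q0 qr.
apply/fbl_norm_leP => //; first exact: powR_ge0.
move=> m u hu; set T := \sum_i N i `^ q.
have T0 : 0 <= T by apply: sumr_ge0 => i _; exact: powR_ge0.
have lam : 0 <= q / r <= 1.
  by rewrite divr_ge0 ?(ltW r0) ?(ltW q0)// ler_pdivrMr// mul1r.
(* Cancelling powers of [N i], among them N_i^(q-r), requires [N i] to be positive; for [N i = 0]
   the values of f_i on the family vanish instead. *)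
have ffN i k : N i = 0 -> `|f i (u k)| = 0.
  move=> Ni; have /(fbl_norm_leP r (f i) (N i) r0 (N0 i)) /(_ m u hu) := fN i.
  rewrite Ni powR0 ?gt_eqF// (bigD1 k)//= => h.
  apply: (@powR_eq0_eq0 _ _ r); apply/eqP; rewrite eq_le powR_ge0 andbT.
  apply: le_trans h; rewrite lerDl sumr_ge0// => j _; exact: powR_ge0.
have step k : (\sum_i `|f i (u k)| `^ q) `^ (r / q) <=
    \sum_i `|f i (u k)| `^ r * N i `^ (q - r) * T `^ (r / q - 1).
  pose A := \sum_i `|f i (u k)| `^ r * N i `^ (q - r).
  have := @holder_sum _ _ (fun i => `|f i (u k)| `^ r * N i `^ (q - r))
    (fun i => N i `^ q) _ T (q / r) _ _ (lexx _) (lexx _) lam.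
  move=> /(_ (fun i => mulr_ge0 (powR_ge0 _ _) (powR_ge0 _ _))).
  move=> /(_ (fun i => powR_ge0 _ _)).
  rewrite -mulr_suml -/A.
  rewrite (eq_bigr (fun i => `|f i (u k)| `^ q)) => [h|i _]; last first.
    have [Ni|NiN0] := eqVneq (N i) 0.
      by rewrite ffN// !powR0 ?gt_eqF// mul0r powR0 ?mul0r// gt_eqF ?divr_gt0.
    have Ni0 : 0 < N i by rewrite lt_neqAle eq_sym NiN0 N0.
    rewrite powRM ?powR_ge0// -!powRrM -mulrA -gt0_powRD//.
    rewrite (_ : r * (q / r) = q); last by field; rewrite gt_eqF.
    rewrite [X in _ * _ `^ X](_ : _ = 0) ?powRr0 ?mulr1//.
    by field; rewrite gt_eqF.
  have A0 : 0 <= A by apply: sumr_ge0 => i _; rewrite mulr_ge0 ?powR_ge0.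
  have rq0 : 0 < r / q by rewrite divr_gt0.
  apply: le_trans (ler_powRl (r / q) _ _ (ltW rq0) _ h) _.
    by apply: sumr_ge0 => i _; exact: powR_ge0.
  rewrite powRM ?powR_ge0// -!powRrM.
  rewrite (_ : q / r * (r / q) = 1) ?powRr1//; last by field; lra.
  by rewrite (_ : (1 - q / r) * (r / q) = r / q - 1)//; field; lra.
under eq_bigr do rewrite ger0_norm ?powR_ge0// -powRrM mulrC.
rewrite -powRrM [_ * r]mulrC; apply: le_trans (ler_sum _ (fun k _ => step k)) _.
rewrite exchange_big/=.
under eq_bigr do rewrite -!mulr_suml.
rewrite -mulr_suml -[leRHS]mulr_powRB1 ?divr_gt0//.
apply: ler_wpM2r; first exact: powR_ge0.
apply: ler_sum => i _.
have [Ni|NiN0] := eqVneq (N i) 0.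
  rewrite big1 ?mul0r ?powR_ge0// => k _.
  by rewrite ffN// powR0 ?gt_eqF.
have Ni0 : 0 < N i by rewrite lt_neqAle eq_sym NiN0 N0.
rewrite (_ : N i `^ q = N i `^ r * N i `^ (q - r)); last first.
  by rewrite -gt0_powRD// subrKC.
apply: ler_wpM2r; first exact: powR_ge0.
by move: (fN i) => /(fbl_norm_leP r (f i) (N i) r0 (N0 i)); exact.
Qed.

Lemma fbl_norm_inf_convex_fin q n (f : 'I_n -> dual E -> R) (N : 'I_n -> R) :
  0 < q -> (forall i, 0 <= N i) ->
  (forall i, (fbl_norm +oo%E (f i) <= (N i)%:E)%E) ->
  (fbl_norm +oo%E (fun u => (\sum_i `|f i u| `^ q) `^ q^-1)%R
     <= ((\sum_i N i `^ q) `^ q^-1)%R%:E)%E.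
Proof.
move=> q0 N0 fN; apply/fbl_norm_inf_leP => u hu.
rewrite ger0_norm ?powR_ge0// ler_powRl ?invr_ge0 ?(ltW q0)//.
  by apply: sumr_ge0 => i _; exact: powR_ge0.
apply: ler_sum => i _; apply: ler_powRl; rewrite ?(ltW q0)//.
by have /fbl_norm_inf_leP := fN i; exact.
Qed.

Lemma fbl_norm_inf_max n (f : 'I_n -> dual E -> R) (N : R) :
  0 <= N -> (forall i, (fbl_norm +oo%E (f i) <= N%:E)%E) ->
  (fbl_norm +oo%E (fun u => \big[Num.max/0]_i `|f i u|)%R <= N%:E)%E.
Proof.
move=> N0 fN; apply/fbl_norm_inf_leP => u hu.
rewrite ger0_norm; last by elim/big_rec: _ => // i y _ y0; rewrite le_max y0 orbT.
apply/bigmax_leP; split=> // i _.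
by have /fbl_norm_inf_leP := fN i; exact.
Qed.

End FBLNorm.

(** * From q-convexity of FBL^(p) to comparison of the r-norm with the q-norm, for r <= p *)

Section Extrapolation.
Context {R : realType} {E : normedModType R}.
Implicit Types (p q r s M N C : R) (f : dual E -> R) (x : E).

(** Convexity is tested on the evaluations at the x_i, whose norms are at most |x_i|. The absolute
    value of [M] enters because the constant may be negative. *)
Lemma q_convex_evaluations p q : 1 <= p -> 0 < q ->
  FBL_q_convex E p%:E q%:E ->
  exists2 M, 0 <= M & forall n (w : 'I_n -> dual E), weakly_summing p n w ->
    forall m (x : 'I_m -> E), \sum_i `|x i| `^ q <= 1 ->
    \sum_k (\sum_i `|w k (x i) : R| `^ q) `^ (p / q) <= M.
Proof.
move=> p1 q0 [M hM]; have p0 : 0 < p := lt_le_trans ltr01 p1.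
exists (`|M| `^ p) => [|n w hw m x hx]; first exact: powR_ge0.
have := hM m (fun i => delta (x i)) (fun i => FBL_delta p (x i) p1).
pose N i := fine (fbl_norm p%:E (delta (x i))).
have NE i : fbl_norm p%:E (delta (x i)) = (N i)%:E.
  by have [y _ e] := fbl_norm_fin p%:E _ p1 (FBL_delta p (x i) p1); rewrite /N e.
have N0 i : 0 <= N i by rewrite -lee_fin -NE fbl_norm_ge0.
have Nx i : N i <= `|x i| by rewrite -lee_fin -NE fbl_norm_delta.
rewrite (poweR_sum_EFin _ _ N)// -EFinM => h.
have /(fbl_norm_leP p _ `|M| p0 (normr_ge0 _)) /(_ n w hw) :
    (fbl_norm p%:E (fun t => (\sum_(k < m) `|delta (x k) t| `^ q) `^ q^-1)%R
       <= `|M|%:E)%E.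
  apply: (le_trans h); rewrite lee_fin.
  apply: (@le_trans _ _ (`|M| * (\sum_i N i `^ q) `^ q^-1)).
    by rewrite ler_wpM2r ?powR_ge0// ler_norm.
  rewrite ler_piMr// powR_le1 ?invr_ge0 ?(ltW q0)//.
    by apply: sumr_ge0 => i _; exact: powR_ge0.
  by apply: le_trans hx; apply: ler_sum => i _; apply: ler_powRl; rewrite ?(ltW q0).
apply: le_trans; apply: ler_sum => k _.
by rewrite ger0_norm ?powR_ge0// -powRrM mulrC.
Qed.

(** The maximum over i of |w_k(x_i)| dominates its term i = k, so each functional may be tested at a
    point of its own. *)
Lemma infty_convex_evaluations p : 1 <= p ->
  FBL_q_convex E p%:E +oo%E ->
  exists2 M, 0 <= M & forall n (w : 'I_n -> dual E), weakly_summing p n w ->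
    forall x : 'I_n -> E, (forall k, `|x k| <= 1) ->
    \sum_k `|w k (x k) : R| `^ p <= M.
Proof.
move=> p1 [M hM]; have p0 : 0 < p := lt_le_trans ltr01 p1.
exists (`|M| `^ p) => [|n w hw x hx]; first exact: powR_ge0.
have := hM n (fun i => delta (x i)) (fun i => FBL_delta p (x i) p1).
set X := \big[maxe/0%E]_k _.
have X0 : (0 <= X)%E.
  by rewrite /X; elim/big_rec: _ => // i y _ y0; rewrite le_max y0 orbT.
have X1 : (X <= 1)%E.
  apply/bigmax_leP; split=> // i _.
  by apply: le_trans (fbl_norm_delta _ _ p0) _; rewrite lee_fin.
move=> h.
have /(fbl_norm_leP p _ `|M| p0 (normr_ge0 _)) /(_ n w hw) :
    (fbl_norm p%:E (fun t => \big[Num.max/0]_(k < n) `|delta (x k) t|)%R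
       <= `|M|%:E)%E.
  apply: (le_trans h); apply: (@le_trans _ _ (`|M|%:E * X)%E).
    by apply: lee_wpmul2r => //; rewrite lee_fin ler_norm.
  by rewrite -[leRHS]mule1; apply: lee_wpmul2l.
apply: le_trans; apply: ler_sum => k _; apply: ler_powRl => //; first exact: ltW.
apply: le_trans (ler_norm _).
by apply: (bigmax_sup k).
Qed.

(* Maurey's extrapolation: [a] is chosen so that, by its near maximality, the
   change of density [g] makes the family [q]-summing with a constant
   comparable to [\sum_k g k]; interpolating with the [r]-summing bound and
   applying the hypothesis at the exponent [p] bounds a sublinear power of
   [\sum_k g k] in terms of itself. *)
Lemma maurey_extrapolation p q r M :
  0 < r -> r <= p -> p < q -> 0 <= M ->
  (forall n (w : 'I_n -> dual E), weakly_summing p n w ->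
    forall m (x : 'I_m -> E), \sum_i `|x i| `^ q <= 1 ->
    \sum_k (\sum_i `|w k (x i) : R| `^ q) `^ (p / q) <= M) ->
  exists2 C, 0 < C & forall n (u : 'I_n -> dual E), weakly_summing r n u ->
    exists g : 'I_n -> R, [/\ forall k, 0 < g k, \sum_k g k <= C &
      forall x, `|x| <= 1 ->
        \sum_k g k `^ (1 - q / r) * `|u k x : R| `^ q <= C].
Proof.
move=> r0 rp pq M0 hM.
have p0 : 0 < p := lt_le_trans r0 rp.
have q0 : 0 < q := lt_trans p0 pq.
have rq : r < q := le_lt_trans rp pq.
pose s := r / q.
have s0 : 0 < s by rewrite divr_gt0.
have s1 : s < 1 by rewrite ltr_pdivrMr// mul1r.
(* Interpolation parameter: p = l q + (1 - l) r. That l < 1 makes the final inequality for [V]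
   solvable. *)
pose l := (p - r) / (q - r).
have l0 : 0 <= l by rewrite divr_ge0//; lra.
have l1 : l < 1 by rewrite ltr_pdivrMr; lra.
(* The second entry bounds any solution of V <= 2 * 6^l * M * V^l; the first covers V <= 1. *)
pose C0 := Num.max 1 ((2 * (6 `^ l * M)) `^ (1 - l)^-1).
have C01 : 1 <= C0 by rewrite le_max lexx.
exists (6 * C0) => [|[|n] u hu]; first lra.
  by exists (fun=> 1); split=> [//||x _]; rewrite big_ord0; lra.
(* Makes the total perturbation (n+1) eps^s equal to 1/2. *)
pose eps : R := (2 * n.+1%:R)^-1 `^ s^-1.
have eps0 : 0 < eps by rewrite powR_gt0// invr_gt0 mulr_gt0.
have epsE : n.+1%:R * eps `^ s = 2^-1.
  rewrite powRVK ?gt_eqF// ?invr_ge0 ?mulr_ge0//.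
  by rewrite invfM mulrCA divff ?pnatr_eq0// mulr1.
pose S : set ('I_n.+1 -> R) := [set a | exists m (x : 'I_m -> E),
  \sum_i `|x i| `^ q <= 1 /\ a = fun k => \sum_i `|u k (x i) : R| `^ q]%classic.
have S1 x : `|x| <= 1 -> S (fun k => `|u k x : R| `^ q).
  move=> x1; exists 1%N, (fun=> x); split; last by apply/funext => k; rewrite big_ord1.
  by rewrite big_ord1 powR_le1// ltW.
have S01 a k : S a -> 0 <= a k <= 1.
  move=> [m [x [hx ->]]]; rewrite sumr_ge0/=; last by move=> i _; exact: powR_ge0.
  apply: le_trans hx; apply: ler_sum => i _; apply: ler_powRl => //; first exact: ltW.
  exact: weakly_summing_le1 r0 hu.
have Scvx t a b : 0 <= t <= 1 -> S a -> S b ->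
    S (fun k => (1 - t) * a k + t * b k).
  (* A convex combination comes from concatenating the two families, scaled by (1-t)^(1/q) and
     t^(1/q). *)
  move=> /andP[t0 t1] [m1 [x1 [hx1 ->]]] [m2 [x2 [hx2 ->]]].
  have t1' : 0 <= 1 - t by rewrite subr_ge0.
  exists (m1 + m2)%N, (fun i => match fintype.split i with
    | inl j => (1 - t) `^ q^-1 *: x1 j | inr j => t `^ q^-1 *: x2 j end).
  split.
    rewrite big_split_ord/=.
    under eq_bigr => i _.
      rewrite (unsplitK (inl i)) normrZ (ger0_norm (powR_ge0 _ _)).
      rewrite powRM ?powR_ge0// powRVK ?gt_eqF//; over.
    under [X in _ + X]eq_bigr => i _.
      rewrite (unsplitK (inr i)) normrZ (ger0_norm (powR_ge0 _ _)).
      rewrite powRM ?powR_ge0// powRVK ?gt_eqF//; over.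
    rewrite -!mulr_sumr.
    have := ler_wpM2l t0 hx2; have := ler_wpM2l t1' hx1; lra.
  apply/funext => k; rewrite big_split_ord/=.
  under [in RHS]eq_bigr => i _.
    rewrite (unsplitK (inl i)) dual_homog normrM (ger0_norm (powR_ge0 _ _)).
    rewrite powRM ?powR_ge0// powRVK ?gt_eqF//; over.
  under [X in _ = _ + X]eq_bigr => i _.
    rewrite (unsplitK (inr i)) dual_homog normrM (ger0_norm (powR_ge0 _ _)).
    rewrite powRM ?powR_ge0// powRVK ?gt_eqF//; over.
  by rewrite -!mulr_sumr.
have S0 : (S !=set0)%classic.
  by exists (fun k => `|u k 0 : R| `^ q); apply: S1; rewrite normr0.
have [|a Sa aP] := near_maximizer_density n.+1 S s eps _ eps0 S0 S01 Scvx.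
  by rewrite s0.
pose b k := a k + eps.
have a0 k : 0 <= a k by have /andP[] := S01 a k Sa.
have b0 k : 0 < b k by rewrite ltr_wpDl.
pose g k := b k `^ s.
have g0 k : 0 < g k by rewrite powR_gt0.
have gE k y : g k `^ y = b k `^ (s * y) by rewrite -powRrM.
pose V := \sum_k g k.
have V0 : 0 < V.
  rewrite /V (bigD1 ord0)//= ltr_pwDl// sumr_ge0// => k _; exact: ltW.
have dens x : `|x| <= 1 ->
    \sum_k g k `^ (1 - q / r) * `|u k x : R| `^ q <= 6 * V.
  move=> x1; have := aP _ (S1 x x1); apply: le_trans.
  apply: ler_sum => k _; rewrite gE /s.
  by rewrite (_ : r / q * (1 - q / r) = r / q - 1)//; field; lra.
suff VC : V <= C0.
  exists g; split=> // [|x x1]; first by rewrite -/V; lra.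
  by have := dens x x1; lra.
have lE : l * (1 - q / r) = 1 - p / r by rewrite /l; field; lra.
(* Since l (1 - q/r) = 1 - p/r, Hölder between [dens] and the r-summing bound makes the family c_k
   u_k weakly p-summing with constant 1. *)
pose c k := (6 * V) `^ (- l / p) * g k `^ (p^-1 - r^-1).
have V60 : 0 < 6 * V by lra.
have c0 k : 0 <= c k by rewrite mulr_ge0 ?powR_ge0.
have cp k : c k `^ p = (6 * V) `^ (- l) * g k `^ (1 - p / r).
  rewrite /c powRMX.
  have -> : - l / p * p = - l by field; rewrite gt_eqF.
  by have -> : (p^-1 - r^-1) * p = 1 - p / r by field; rewrite !gt_eqF.
have hw : weakly_summing p n.+1 (fun k => c k *: u k).
  move=> x x1.
  rewrite (eq_bigr (fun k => (6 * V) `^ (- l) *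
      ((g k `^ (1 - q / r) * `|u k x : R| `^ q) `^ l *
       (`|u k x : R| `^ r) `^ (1 - l)))).
    rewrite -mulr_sumr powRN ler_pdivrMl ?powR_gt0// mulr1.
    have lam : 0 <= l <= 1 by rewrite l0 ltW.
    have := @holder_sum _ _ (fun k => g k `^ (1 - q / r) * `|u k x : R| `^ q)
      (fun k => `|u k x : R| `^ r) _ 1 l
      (fun k => mulr_ge0 (powR_ge0 _ _) (powR_ge0 _ _))
      (fun k => powR_ge0 _ _) (dens x x1) (hu x x1) lam.
    by rewrite powR1 mulr1.
  move=> k _; rewrite dualZ normrM (ger0_norm (c0 k)) [LHS]powRM// cp.
  rewrite powRMX -[(_ `^ r) `^ _]powRrM -!mulrA; congr (_ * _).
  rewrite [(1 - q / r) * l]mulrC lE; congr (_ * _).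
  have e : q * l + r * (1 - l) = p by rewrite /l; field; lra.
  by rewrite -powRD e// gt_eqF.
have [m [x [hx aE]]] := Sa.
have akE k : a k = \sum_i `|u k (x i) : R| `^ q by rewrite [in LHS]aE.
have := hM _ _ hw m x hx.
rewrite (eq_bigr (fun k => (6 * V) `^ (- l) *
   (g k `^ (1 - p / r) * a k `^ (p / q)))); last first.
  move=> k _; rewrite (eq_bigr (fun i => c k `^ q * `|u k (x i) : R| `^ q)).
    rewrite -mulr_sumr -akE mulrA -cp powRM ?powR_ge0 ?a0//; congr (_ * _).
    by rewrite -powRrM; congr (_ `^ _); field; rewrite gt_eqF.
  by move=> i _; rewrite dualZ normrM (ger0_norm (c0 k)) [LHS]powRM.
rewrite -mulr_sumr powRN ler_pdivrMl ?powR_gt0// => hMV.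
(* Termwise: b^(s-1) a = b^s (a/b) <= b^s (a/b)^(p/q), because a <= b and p < q. *)
have : \sum_k b k `^ (s - 1) * a k <= (6 * V) `^ l * M.
  apply: le_trans hMV; apply: ler_sum => k _.
  rewrite gE (_ : s * (1 - p / r) = s - p / q); last by rewrite /s; field; lra.
  rewrite !gt0_powRD// -!mulrA ler_pM2l ?powR_gt0// powR_inv1 ?(ltW (b0 k))//.
  rewrite powRN -[(b k `^ _)^-1]powR_inv1 ?powR_ge0// powRAC -powRM ?a0 ?powR_ge0//.
  rewrite powR_inv1 ?(ltW (b0 k))//; apply: le_powR_le1.
    rewrite mulr_ge0 ?invr_ge0 ?(ltW (b0 k))//= ler_pdivrMl// mulr1.
    by rewrite lerDl ltW.
  by rewrite ler_pdivrMr// mul1r ltW.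
(* Write b^s = b^(s-1) (a + eps); as b >= eps and s < 1, the second part is at most eps^s. *)
have : V <= \sum_k b k `^ (s - 1) * a k + 2^-1.
  rewrite -epsE mulr_natl -[X in _ *+ X]card_ord -sumr_const -big_split/=.
  apply: ler_sum => k _; rewrite /g -(mulr_powRB1 (ltW (b0 k)) s0) {1}/b mulrC mulrDr.
  rewrite lerD2l mulrC -(mulr_powRB1 (ltW eps0) s0) ler_wpM2l ?(ltW eps0)//.
  by apply: ler_npowRl; rewrite ?lerDr//; lra.
move=> h1 h2.
rewrite le_max; have [//|V1/=] := leP V 1.
(* For V > 1 the additive 1/2 is less than V/2 and is absorbed on the left. *)
have : V <= 2 * (6 `^ l * M) * V `^ l.
  by move: h2; rewrite powRM ?(ltW V0)//; lra.
rewrite -ler_pdivrMr ?powR_gt0// -powRN.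
rewrite -{1}(powRr1 (ltW V0)) -gt0_powRD// => h.
have l10 : 0 < 1 - l by lra.
rewrite -[leLHS](@powRK _ (1 - l)) ?gt_eqF ?(ltW V0)//.
by apply: ler_powRl; rewrite ?invr_ge0 ?powR_ge0 ?(ltW l10).
Qed.

(** The density [g] turns u_k into the weakly q-summing family c_k u_k, on which the q-norm of [f]
    is tested. Hölder against [g], of mass at most C, returns to exponent r and cancels all powers
    of [g]. *)
Lemma fbl_norm_comparison_fin p q r M :
  0 < r -> r <= p -> p < q -> 1 <= p -> FBL_q_convex E p%:E q%:E ->
  exists2 C, 0 <= C & forall f N, pos_homogeneous E f -> 0 <= N ->
    (fbl_norm q%:E f <= N%:E)%E -> (fbl_norm r%:E f <= (C * N)%:E)%E.
Proof.
move=> r0 rp pq p1 conv.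
have rq : r < q := le_lt_trans rp pq.
have q0 : 0 < q := lt_trans r0 rq.
have [M0 M00 hM] := q_convex_evaluations p q p1 q0 conv.
have [C C0 hC] := maurey_extrapolation p q r M0 r0 rp pq M00 hM.
exists (C `^ r^-1) => [|f N hf N0 /(fbl_norm_leP q f N q0 N0) hN].
  exact: powR_ge0.
apply/fbl_norm_leP => [//||n u hu]; first by rewrite mulr_ge0 ?powR_ge0.
have [g [g0 gC dens]] := hC n u hu.
pose c k := C `^ (- q^-1) * g k `^ (q^-1 - r^-1).
have c0 k : 0 <= c k by rewrite mulr_ge0 ?powR_ge0.
have cq k : c k `^ q = C^-1 * g k `^ (1 - q / r).
  rewrite /c powRMX -[C^-1]powR_inv1 ?(ltW C0)//.
  have -> : - q^-1 * q = -1 by field; rewrite gt_eqF.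
  by have -> : (q^-1 - r^-1) * q = 1 - q / r by field; rewrite !gt_eqF.
have hw : weakly_summing q n (fun k => c k *: u k).
  move=> x x1; rewrite (eq_bigr (fun k => C^-1 *
    (g k `^ (1 - q / r) * `|u k x : R| `^ q))).
    by rewrite -mulr_sumr ler_pdivrMl// mulr1 dens.
  by move=> k _; rewrite dualZ normrM (ger0_norm (c0 k)) [LHS]powRM// cq mulrA.
have := hN n _ hw.
rewrite (eq_bigr (fun k => C^-1 *
    (g k `^ (1 - q / r) * `|f (u k)| `^ q))); last first.
  by move=> k _; rewrite hf// normrM (ger0_norm (c0 k)) powRM// cq mulrA.
rewrite -mulr_sumr ler_pdivrMl// => hA.
have lam : 0 <= r / q <= 1.
  by rewrite divr_ge0 ?(ltW r0) ?(ltW q0)// ler_pdivrMr// mul1r ltW.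
have := @holder_sum _ _ (fun k => g k `^ (1 - q / r) * `|f (u k)| `^ q) g _ _
  (r / q) (fun k => mulr_ge0 (powR_ge0 _ _) (powR_ge0 _ _))
  (fun k => ltW (g0 k)) hA gC lam.
rewrite powRM ?powR_ge0 ?(ltW C0)// mulrAC -gt0_powRD// subrKC powRr1 ?(ltW C0)//.
have qrq : q * (r / q) = r by field; rewrite gt_eqF.
rewrite -powRrM qrq => hB.
rewrite [leRHS]powRM ?powR_ge0// powRVK ?(ltW C0) ?gt_eqF//; apply: le_trans hB.
apply: ler_sum => k _; rewrite powRMX mulrAC -gt0_powRD// qrq.
have -> : (1 - q / r) * (r / q) + (1 - r / q) = 0 by field; rewrite !gt_eqF.
by rewrite powRr0 mul1r.
Qed.

(** The sup-norm gives |f(u_k)| <= N |u_k|, so it suffices to bound the sum of |u_k|^r. The family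
    scaled by |u_k|^(r/p-1) is weakly p-summing and is tested at points nearly norming each u_k. *)
Lemma fbl_norm_comparison_inf p r :
  0 < r -> r <= p -> 1 <= p -> FBL_q_convex E p%:E +oo%E ->
  exists2 C, 0 <= C & forall f N, pos_homogeneous E f -> 0 <= N ->
    (fbl_norm +oo%E f <= N%:E)%E -> (fbl_norm r%:E f <= (C * N)%:E)%E.
Proof.
move=> r0 rp p1 conv; have p0 : 0 < p := lt_le_trans r0 rp.
have [M M0 hM] := infty_convex_evaluations p p1 conv.
exists ((2 `^ p * M) `^ r^-1) => [|f N hf N0 /fbl_norm_inf_leP hN].
  exact: powR_ge0.
apply/fbl_norm_leP => [//||n u hu]; first by rewrite mulr_ge0 ?powR_ge0.
pose D k := [set `|u k x : R| | x in unit_ball E]%classic.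
pose nu k := sup (D k).
have hD k : has_sup (D k).
  split; first by exists `|u k 0|, 0 => //; rewrite /unit_ball/= normr0.
  exists 1 => _ [x x1 <-]; apply: le_trans x1.
  exact: weakly_summing_le1 r0 hu.
have unu k x : `|x| <= 1 -> `|u k x : R| <= nu k.
  by move=> x1; apply: ub_le_sup; [case: (hD k) | exists x].
have nu0 k : 0 <= nu k by apply: le_trans (unu k 0 _); rewrite ?normr0.
(* The norm need not be attained; settling for half of it costs the factor 2^p. *)
have near k : exists x, `|x| <= 1 /\ nu k / 2 <= `|u k x : R|.
  have := nu0 k; rewrite le_eqVlt => /predU1P[<-|nup].
    by exists 0; rewrite normr0 mul0r.
  have nu2 : 0 < nu k / 2 by rewrite divr_gt0.
  have [_ [x x1 <-] hx] := sup_adherent nu2 (hD k).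
  by exists x; split=> //; rewrite -/(nu k) in hx; lra.
have [x /all_and2[x1 hx]] := choice near.
pose c k := nu k `^ (r / p - 1).
have c0 k : 0 <= c k by exact: powR_ge0.
have cp k : c k `^ p = nu k `^ (r - p).
  by rewrite -powRrM; congr (_ `^ _); field; lra.
have hw : weakly_summing p n (fun k => c k *: u k).
  move=> y y1; apply: le_trans (hu y y1); apply: ler_sum => k _.
  rewrite dualZ normrM (ger0_norm (c0 k)) powRM// cp.
  have [->|uN0] := eqVneq (u k y : R) 0.
    by rewrite normr0 powR0 ?gt_eqF// mulr0 powR_ge0.
  have u0 : 0 < `|u k y : R| by rewrite normr_gt0.
  have nup : 0 < nu k := lt_le_trans u0 (unu k y y1).
  have -> : `|u k y : R| `^ p = `|u k y : R| `^ r * `|u k y : R| `^ (p - r).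
    by rewrite -gt0_powRD// subrKC.
  rewrite mulrCA ler_piMr ?powR_ge0//.
  rewrite -opprB powRN ler_pdivrMl ?powR_gt0// mulr1.
  by apply: ler_powRl => //; [lra | exact: unu].
have nuM : \sum_k nu k `^ r <= 2 `^ p * M.
  rewrite -ler_pdivrMl ?powR_gt0//; apply: le_trans (hM n _ hw x x1).
  rewrite mulr_sumr; apply: ler_sum => k _.
  rewrite dualZ normrM (ger0_norm (c0 k)) powRM// cp.
  have := nu0 k; rewrite le_eqVlt => /predU1P[<-|nup].
    by rewrite (powR0 (lt0r_neq0 r0)) mulr0 mulr_ge0 ?powR_ge0.
  have nu2 : 0 <= nu k / 2 by rewrite divr_ge0.
  apply: le_trans (ler_wpM2l (powR_ge0 _ _) (ler_powRl _ _ _ (ltW p0) nu2 (hx k))).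
  rewrite powRM ?invr_ge0// mulrA -gt0_powRD// subrK mulrC.
  by rewrite -[in leRHS]powR_inv1// powRAC powR_inv1 ?powR_ge0.
have K0 : 0 <= 2 `^ p * M by exact: mulr_ge0 (powR_ge0 _ _) M0.
rewrite (powRM _ (powR_ge0 _ _) N0) (powRVK r _ (lt0r_neq0 r0) K0).
apply: le_trans (ler_wpM2r (powR_ge0 _ _) nuM); rewrite mulr_suml.
apply: ler_sum => k _; rewrite -powRM//; apply: ler_powRl => //; first exact: ltW.
(* Dividing by [e] instead of [nu k] covers [nu k = 0]; the excess N d / (N + 1) stays below d. *)
apply/ler_addgt0Pr => d d0; pose e := nu k + d / (N + 1).
have N10 : 0 < N + 1 by lra.
have dN : 0 < d / (N + 1) by rewrite divr_gt0.
have e0 : 0 < e by rewrite ltr_wpDl.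
have : `|f (e^-1 *: u k)| <= N.
  apply: hN => y y1; rewrite dualZ normrM gtr0_norm ?invr_gt0//.
  by rewrite ler_pdivrMl// mulr1 (le_trans (unu k y y1))// lerDl ltW.
rewrite hf ?invr_ge0 ?(ltW e0)// normrM gtr0_norm ?invr_gt0//.
rewrite ler_pdivrMl// => /le_trans; apply; rewrite mulrDl lerD2l.
by rewrite mulrAC ler_pdivrMr// ler_pM2l//; lra.
Qed.

End Extrapolation.

(** * Comparison for all finite r, and transfer of convexity *)

Section Transfer.
Context {R : realType} {E : normedModType R}.
Implicit Types (p q r N C : R) (f : dual E -> R).

Lemma fbl_norm_antitone (r q : \bar R) f N : (1 <= r)%E -> (r <= q)%E ->
  0 <= N -> pos_homogeneous E f ->
  (fbl_norm r f <= N%:E)%E -> (fbl_norm q f <= N%:E)%E.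
Proof.
case: r => [r| |] r1; [|by case: q|by []].
have r0 : 0 < r by rewrite (lt_le_trans ltr01).
case: q => [q| |] rq N0 hf; [|exact: (fbl_norm_antitone_inf r)|by []].
exact: fbl_norm_antitone_fin r0 rq N0 hf.
Qed.

(** Extrapolation applies at the exponent min(r, p) <= p; monotonicity of the norms then raises it
    to r. *)
Lemma fbl_norm_comparison p r (q : \bar R) :
  1 <= p -> (p%:E < q)%E -> FBL_q_convex E p%:E q -> 1 <= r ->
  exists2 C, 0 <= C & forall f N, pos_homogeneous E f -> 0 <= N ->
    (fbl_norm q f <= N%:E)%E -> (fbl_norm r%:E f <= (C * N)%:E)%E.
Proof.
move=> p1 pq conv r1; pose s := Num.min r p.
have s1 : 1 <= s by rewrite le_min r1.
have s0 : 0 < s := lt_le_trans ltr01 s1.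
have sp : s <= p by rewrite ge_min lexx orbT.
have [C C0 hC] : exists2 C, 0 <= C & forall f N, pos_homogeneous E f ->
    0 <= N -> (fbl_norm q f <= N%:E)%E -> (fbl_norm s%:E f <= (C * N)%:E)%E.
  case: q => [q| |] // in pq conv *.
    exact: fbl_norm_comparison_fin s0 sp pq p1 conv.
  exact: fbl_norm_comparison_inf s0 sp p1 conv.
have sr : (s%:E <= r%:E)%E by rewrite lee_fin ge_min lexx.
exists C; first exact: C0.
move=> f N hf N0 hN.
exact: fbl_norm_antitone s%:E r%:E f _ s1 sr (mulr_ge0 C0 N0) hf (hC f N hf N0 hN).
Qed.

Lemma pos_homogeneous_powR_sum q n (f : 'I_n -> dual E -> R) : 0 < q ->
  (forall i, pos_homogeneous E (f i)) ->
  pos_homogeneous E (fun u => (\sum_i `|f i u| `^ q) `^ q^-1).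
Proof.
move=> q0 hf a u a0.
under eq_bigr do rewrite hf// normrM (ger0_norm a0) powRM//.
rewrite -mulr_sumr powRM ?powR_ge0 ?powRK ?gt_eqF//.
by apply: sumr_ge0 => i _; exact: powR_ge0.
Qed.

Lemma pos_homogeneous_bigmax n (f : 'I_n -> dual E -> R) :
  (forall i, pos_homogeneous E (f i)) ->
  pos_homogeneous E (fun u => \big[Num.max/0]_i `|f i u|).
Proof.
move=> hf a u a0.
rewrite (big_morph ( *%R a) (fun x y => maxr_pMr x y a0) (mulr0 a)).
by apply: eq_bigr => i _; rewrite hf// normrM (ger0_norm a0).
Qed.

End Transfer.

Theorem theorem9p40 (R : realType) (E : completeNormedModType R)
    (p : R) (q : \bar R) :
  1 <= p -> (p%:E < q)%E -> FBL_q_convex E p%:E q ->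
  forall r : \bar R, (1 <= r)%E -> FBL_q_convex E r q.
Proof.
move=> p1 pq conv r r1.
have N_ n (f : 'I_n -> dual E -> R) : (forall i, FBL E r (f i)) ->
    exists2 N : 'I_n -> R, forall i, 0 <= N i &
      forall i, fbl_norm r (f i) = (N i)%:E.
  move=> hf; exists (fun i => fine (fbl_norm r (f i))) => i;
    by have [N N0 ->] := fbl_norm_fin r _ r1 (hf i).
case: q => [q| |] // in pq conv *; rewrite /FBL_q_convex/=.
- have q0 : 0 < q by rewrite lte_fin in pq; apply: lt_trans pq; apply: lt_le_trans p1.
  suff [C hC] : exists C, forall n (f : 'I_n -> dual E -> R) (N : 'I_n -> R),
      (forall i, FBL E r (f i)) -> (forall i, 0 <= N i) ->
      (forall i, (fbl_norm r (f i) <= (N i)%:E)%E) ->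
      (fbl_norm r (fun u => (\sum_i `|f i u| `^ q) `^ q^-1)%R
        <= (C * (\sum_i N i `^ q) `^ q^-1)%R%:E)%E.
    exists C => n f hf; have [N N0 NE] := N_ n f hf.
    rewrite (poweR_sum_EFin _ _ N)// -EFinM.
    by apply: hC => // i; rewrite NE.
  have [qr|rq] := leP q%:E r.
    exists 1 => n f N _ N0 fN; rewrite mul1r.
    case: r => [r| |] in r1 N_ qr fN *; [|exact: fbl_norm_inf_convex_fin|by []].
    exact: fbl_norm_convex_fin.
  (* For r < q: pass from the r-norm to the q-norm of each f_i, use Minkowski with constant 1 there,
     and compare back. *)
  case: r => [r| |] in r1 N_ rq *; [|by []|by []].
  have [C C0 hC] := fbl_norm_comparison p r q%:E p1 pq conv r1.
  exists C => n f N hf N0 fN.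
  have hom i : pos_homogeneous E (f i) by case: (hf i).
  apply: hC; [exact: pos_homogeneous_powR_sum|exact: powR_ge0|].
  apply: fbl_norm_convex_fin; [exact: q0|exact: lexx|exact: N0|move=> i].
  exact: fbl_norm_antitone r%:E q%:E (f i) (N i) r1 (ltW rq) (N0 i) (hom i) (fN i).
(* For q infinite, a common bound N on the norms suffices: it is applied to their maximum. *)
- suff [C hC] : exists C, forall n (f : 'I_n -> dual E -> R) (N : R),
      (forall i, FBL E r (f i)) -> 0 <= N ->
      (forall i, (fbl_norm r (f i) <= N%:E)%E) ->
      (fbl_norm r (fun u => \big[Num.max/0]_i `|f i u|)%R <= (C * N)%:E)%E.
    exists C => n f hf; have [N N0 NE] := N_ n f hf.
    rewrite (eq_bigr (fun i => (N i)%:E)); last by move=> i _; exact: NE.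
    rewrite -(big_morph EFin EFin_max erefl) -EFinM; apply: hC => // [|i].
      by elim/big_rec: _ => // i y _ y0; rewrite le_max y0 orbT.
    by rewrite NE lee_fin; exact: le_bigmax.
  case: r => [r| |] in r1 N_ *; [| |by []].
    have [C C0 hC] := fbl_norm_comparison p r +oo%E p1 pq conv r1.
    exists C => n f N hf N0 fN.
    have hom i : pos_homogeneous E (f i) by case: (hf i).
    apply: hC; [exact: pos_homogeneous_bigmax|exact: N0|].
    apply: fbl_norm_inf_max; [exact: N0|move=> i].
    exact: fbl_norm_antitone r%:E +oo%E (f i) N r1 (leey _) N0 (hom i) (fN i).
  by exists 1 => n f N _ N0 fN; rewrite mul1r; exact: fbl_norm_inf_max.
Qed.
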